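(* Let $\mathcal{P}$ be a hereditary graph property and let $G$ be a graph with vertices $v_1,\dots,v_n$. Let $K=|\mathcal{P}^m(G)|$. Then the algorithm GenHered (described in the context) applied to $G$ returns exactly $\mathcal{P}^m(G)$, and it runs in time $O\big(n^2\, s_{\mathcal{P}}(n)\, K\, r_{\mathcal{P}}(n,K)\big)$.
   Context: A graph is a triple $G=(V,E,r)$ with $V$ a finite set of vertices, $E\subseteq V\times V$ a set of (directed) edges, and a root $r\in V\cup\{\bot\}$. $H$ is an induced subgraph of $G$, written $H\subseteq_{\mathrm{IS}} G$, if $H$ is obtained from $G$ by deleting some vertices (and the edges incident to them), and the root of $H$ equals the root of $G$ if that root is still a vertex of $H$, and is $\bot$ otherwise; $H\subset_{\mathrm{IS}} G$ means $H\subseteq_{\mathrm{IS}} G$ and $H\neq G$. For $U\subseteq V$, $G[U]$ is the induced subgraph of $G$ with vertex set $U$, and $G[H,v]$ abbreviates $G[V(H)\cup\{v\}]$; $G-v$ is $G[V\setminus\{v\}]$. A graph property is a nonempty (possibly infinite) set $\mathcal{P}$ of graphs; it is assumed that membership $G\in\mathcal{P}$ can be tested in polynomial time, and $s_{\mathcal{P}}(n)$ denotes the time needed to test membership for a graph with $n$ vertices. $\mathcal{P}$ is hereditary if whenever $G\in\mathcal{P}$, every induced subgraph of $G$ is in $\mathcal{P}$. A $\mathcal{P}$-subgraph of $G$ is an $H\subseteq_{\mathrm{IS}}G$ with $H\in\mathcal{P}$; it is maximal if there is no $\mathcal{P}$-subgraph $H'$ of $G$ with $H\subset_{\mathrm{IS}}H'$;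 $\mathcal{P}^m(G)$ is the set of maximal $\mathcal{P}$-subgraphs of $G$. $G$ almost satisfies $\mathcal{P}$ if $G-v\in\mathcal{P}$ for some vertex $v$. Fix a procedure $\mathrm{R}$ which, given a graph $H$ that almost satisfies $\mathcal{P}$, returns $\mathcal{P}^m(H)$; $r_{\mathcal{P}}(n,K)$ denotes its running time on an input with $n$ vertices whose output consists of $K$ graphs. Algorithm GenHered on input $G$ with vertices $v_1,\dots,v_n$: initialize a collection $\mathcal{G}=\{O_0\}$, where $O_0$ is the graph with no vertices and no edges. For $i=1,\dots,n$: let $\mathcal{H}$ be a copy of the current $\mathcal{G}$; for each $H\in\mathcal{H}$, remove $H$ from $\mathcal{G}$, and then for each $H'\in\mathrm{R}(G[H,v_i])$, if $H'$ is a maximal $\mathcal{P}$-subgraph of $G[\{v_1,\dots,v_i\}]$ then add $H'$ to $\mathcal{G}$. After the loop, return $\mathcal{G}$.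
   Formalization: The time bounds s_P(n) and r_P(n,K) are assumed nondecreasing in n and K, since GenHered tests smaller induced subgraphs and the bound fails otherwise; a test takes at least one step, outputting K graphs at least K steps, and the time bound is for n ≥ 1. *)

(* Defs.v *)
From HB Require Import structures.
From mathcomp Require Import all_boot finmap.
From mathcomp Require Import boolp.

Set Implicit Arguments.
Unset Strict Implicit.
Unset Printing Implicit Defensive.

Local Open Scope fset_scope.

(* Graphs (V, E, r) with vertices drawn from a universe T of vertex names;
   r = None stands for the root "bottom". *)

Definition graph_wf (T : choiceType)
    (x : {fset T} * {fset T * T} * option T) : bool :=
  all (fun e => (e.1 \in x.1.1) && (e.2 \in x.1.1)) (enum_fset x.1.2)
  && (if x.2 is Some r then r \in x.1.1 else true).

Record graph (T : choiceType) := Graph {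
  gdata : {fset T} * {fset T * T} * option T;
  _ : graph_wf gdata }.

HB.instance Definition _ (T : choiceType) := [isSub for @gdata T].
HB.instance Definition _ (T : choiceType) := [Choice of graph T by <:].

Definition vertices (T : choiceType) (G : graph T) : {fset T} := (gdata G).1.1.
Definition edges (T : choiceType) (G : graph T) : {fset T * T} := (gdata G).1.2.
Definition groot (T : choiceType) (G : graph T) : option T := (gdata G).2.

Lemma graph0_wf (T : choiceType) :
  graph_wf (fset0 : {fset T}, fset0 : {fset T * T}, None : option T).
Proof. by apply/andP; split => //; apply/allP => e; rewrite inE. Qed.

Definition graph0 (T : choiceType) : graph T := Graph (graph0_wf T).

Definition induced_data (T : choiceType) (G : graph T) (U : {fset T}) :=
  (vertices G `&` U,
   [fset e in edges G | (e.1 \in U) && (e.2 \in U)],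
   if groot G is Some r then if r \in U then Some r else None else None).

Lemma induced_wf (T : choiceType) (G : graph T) (U : {fset T}) :
  graph_wf (induced_data G U).
Proof.
case: G => [[[V E] r] wf]; have /andP[/= /allP EV rV] := wf.
rewrite /graph_wf /induced_data /vertices /edges /groot /=; apply/andP; split.
  apply/allP => e; rewrite !inE /= => /andP[eE /andP[e1 e2]].
  by have /andP[-> ->] := EV e eE; rewrite e1 e2.
by case: r {wf} rV => // r rV; case: ifP => // rU; rewrite inE rV.
Qed.

(* G[U] *)
Definition induced (T : choiceType) (G : graph T) (U : {fset T}) : graph T :=
  Graph (induced_wf G U).

(* G[H, v] *)
Definition induced_add (T : choiceType) (G H : graph T) (v : T) : graph T :=
  induced G (v |` vertices H).

(* G - v *)
Definition del_vertex (T : choiceType) (G : graph T) (v : T) : graph T :=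
  induced G (vertices G `\ v).

Definition induced_subgraph (T : choiceType) (H G : graph T) : Prop :=
  exists2 U : {fset T}, U `<=` vertices G & H = induced G U.

Definition proper_induced_subgraph (T : choiceType) (H G : graph T) : Prop :=
  induced_subgraph H G /\ H <> G.

Definition graph_property (T : choiceType) (P : graph T -> Prop) : Prop :=
  exists G, P G.

Definition hereditary (T : choiceType) (P : graph T -> Prop) : Prop :=
  forall G H, P G -> induced_subgraph H G -> P H.

Definition P_subgraph (T : choiceType) (P : graph T -> Prop) (G H : graph T) :
    Prop :=
  induced_subgraph H G /\ P H.

Definition maximal_P_subgraph (T : choiceType) (P : graph T -> Prop)
    (G H : graph T) : Prop :=
  P_subgraph P G H /\
  ~ (exists H', P_subgraph P G H' /\ proper_induced_subgraph H H').

(* P^m(G); the fpowerset only serves to bound the comprehension. *)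
Definition max_P_subgraphs (T : choiceType) (P : graph T -> Prop)
    (G : graph T) : {fset graph T} :=
  [fset H in [fset induced G U | U in fpowerset (vertices G)]
     | `[< maximal_P_subgraph P G H >]].

Lemma in_max_P_subgraphs (T : choiceType) (P : graph T -> Prop)
    (G H : graph T) :
  H \in max_P_subgraphs P G <-> maximal_P_subgraph P G H.
Proof.
rewrite !inE /=; split=> [/andP[_ /asboolP]//|maxH].
apply/andP; split; last exact/asboolP.
have [[[U UG ->] _] _] := maxH.
by apply: in_imfset; rewrite /= fpowersetE.
Qed.

Definition almost_satisfies (T : choiceType) (P : graph T -> Prop)
    (G : graph T) : Prop :=
  exists2 v, v \in vertices G & P (del_vertex G v).

(* Computations instrumented with the number of elementary steps they take. *)

Record timed (A : Type) := Timed { result : A; time : nat }.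

Definition ret (A : Type) (a : A) : timed A := Timed a 0.

Definition bind (A B : Type) (m : timed A) (f : A -> timed B) : timed B :=
  Timed (result (f (result m))) (time m + time (f (result m))).

Definition tick (k : nat) : timed unit := Timed tt k.

Declare Scope timed_scope.
Delimit Scope timed_scope with timed.
Notation "x <-- m ;; k" := (bind m (fun x => k))
  (at level 100, m at next level, right associativity) : timed_scope.
Notation "m ;;; k" := (bind m (fun _ => k))
  (at level 100, right associativity) : timed_scope.

Local Open Scope timed_scope.

Fixpoint for_each (A S : Type) (l : seq A) (st : S) (body : A -> S -> timed S) :
    timed S :=
  if l is a :: l' then
    tick 1 ;;; st' <-- body a st ;; for_each l' st' body
  else ret st.

(* Cost model. The input graph is stored once, and an induced subgraph of it
   is represented by the 0/1 vector of its vertices, indexed by v_1, ..., v_n.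
   Hence reading or writing one entry is one step, copying a subgraph takes
   n + 1 steps, and a collection of subgraphs is a binary trie of such
   vectors: insertion and removal take n + 1 steps, and listing a collection
   of k subgraphs takes (n + 1) * (k + 1) steps. *)

Definition coll_copy (T : choiceType) (n : nat) (C : {fset graph T}) :
    timed (seq (graph T)) :=
  tick (n.+1 * #|` C|.+1) ;;; ret (enum_fset C).

Definition coll_remove (T : choiceType) (n : nat) (H : graph T)
    (C : {fset graph T}) : timed {fset graph T} :=
  tick n.+1 ;;; ret (C `\ H).

Definition coll_add (T : choiceType) (n : nat) (H : graph T)
    (C : {fset graph T}) : timed {fset graph T} :=
  tick n.+1 ;;; ret (H |` C).

(* M decides membership in P, in at least one step and at most s n steps on
   graphs with n vertices. *)
Record membership_test (T : choiceType) (P : graph T -> Prop)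
    (M : graph T -> timed bool) (s : nat -> nat) : Prop := {
  test_correct : forall G, result (M G) <-> P G;
  test_pos : forall G, 0 < time (M G);
  test_time : forall G, time (M G) <= s #|` vertices G|;
  test_mono : forall n n', n <= n' -> s n <= s n' }.

Definition polynomially_bounded (s : nat -> nat) : Prop :=
  exists c d, forall n, s n <= c * n ^ d + c.

(* R lists P^m(H), without repetition, for every H that almost satisfies P;
   nothing is assumed on other inputs. Producing K graphs takes at least K
   steps, and at most r n K steps if H has n vertices. *)
Record restricted_procedure (T : choiceType) (P : graph T -> Prop)
    (R : graph T -> timed (seq (graph T))) (r : nat -> nat -> nat) : Prop := {
  proc_uniq : forall H, almost_satisfies P H -> uniq (result (R H));
  proc_correct : forall H, almost_satisfies P H ->
    result (R H) =i max_P_subgraphs P H;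
  proc_output : forall H, almost_satisfies P H ->
    size (result (R H)) <= time (R H);
  proc_time : forall H, almost_satisfies P H ->
    time (R H) <= r #|` vertices H| #|` max_P_subgraphs P H|;
  proc_mono : forall n n' K K', n <= n' -> K <= K' -> r n K <= r n' K' }.

(* Is no G[H, v], with v in us outside H, in P? For each such v, the entry of v
   in the vector of H is set, M is run, and the entry is cleared again. *)
Fixpoint no_extension (T : choiceType) (M : graph T -> timed bool)
    (G : graph T) (us : seq T) (H : graph T) : timed bool :=
  if us is v :: us' then
    tick 1 ;;;
    if v \in vertices H then no_extension M G us' H
    else
      tick 2 ;;;
      b <-- M (induced_add G H v) ;;
      if b then ret false else no_extension M G us' H
  else ret true.

(* Test that H is a maximal P-subgraph of G[us], for a hereditary P. *)
Definition maximality_test (T : choiceType) (M : graph T -> timed bool)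
    (n : nat) (G : graph T) (us : seq T) (H : graph T) : timed bool :=
  tick n.+1 ;;;
  b <-- M H ;;
  if b then no_extension M G us H else ret false.

(* The i-th iteration, with us = [:: v_1; ...; v_i] and v = v_i. *)
Definition gen_hered_step (T : choiceType) (M : graph T -> timed bool)
    (R : graph T -> timed (seq (graph T))) (n : nat) (G : graph T)
    (us : seq T) (v : T) (C : {fset graph T}) : timed {fset graph T} :=
  Hs <-- coll_copy n C ;;
  for_each Hs C (fun H C1 =>
    C2 <-- coll_remove n H C1 ;;
    tick n.+1 ;;;
    Hs' <-- R (induced_add G H v) ;;
    for_each Hs' C2 (fun H' C3 =>
      b <-- maximality_test M n G us H' ;;
      if b then coll_add n H' C3 else ret C3)).

Fixpoint gen_hered_loop (T : choiceType) (M : graph T -> timed bool)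
    (R : graph T -> timed (seq (graph T))) (n : nat) (G : graph T)
    (us vs : seq T) (C : {fset graph T}) : timed {fset graph T} :=
  if vs is v :: vs' then
    tick 1 ;;;
    C' <-- gen_hered_step M R n G (rcons us v) v C ;;
    gen_hered_loop M R n G (rcons us v) vs' C'
  else ret C.

Definition gen_hered (T : choiceType) (M : graph T -> timed bool)
    (R : graph T -> timed (seq (graph T))) (G : graph T) (vs : seq T) :
    timed {fset graph T} :=
  tick 1 ;;;
  gen_hered_loop M R (size vs) G [::] vs [fset graph0 T].

Definition vertex_enumeration (T : choiceType) (G : graph T) (vs : seq T) :
    Prop :=
  uniq vs /\ vs =i vertices G.

(* Main.v *)
Require Import Defs.
From mathcomp Require Import all_boot finmap.
From mathcomp Require Import boolp zify.

Set Implicit Arguments.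
Unset Strict Implicit.
Unset Printing Implicit Defensive.

(** The collection after [i] rounds is [P^m(G_i)], where [G_i = G[v_1, ..., v_i]].
    A maximal [P]-subgraph [H'] of [G_(i+1)] loses at most [v_(i+1)] when cut down
    to [G_i]; by heredity the rest extends to some [H] in [P^m(G_i)], so [H'] is
    found by [R] inside [G[H, v_(i+1)]].  For the running time, the number of maximal
    [P]-subgraphs can only grow when passing from an induced subgraph [G1] of [G] to
    [G]: each member of [P^m(G1)] is the trace on [G1] of any of its maximal
    extensions in [G].  Hence neither the intermediate collections nor the outputs
    of [R] ever have more than [K] members. *)

(* The left-hand sides of the next four bounds count the steps of one maximality
   test, of the replacement of one [H], of one round and of the whole algorithm,
   where [S] and [Q] bound the running times of [M] and [R]. *)
Lemma maximality_cost_le (n S : nat) :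
  0 < n -> 0 < S -> n.+1 + S + n * (S + 3) <= 7 * (n * S).
Proof. nia. Qed.

Lemma replacement_cost_le (n S Q : nat) :
    0 < n -> 0 < S -> 0 < Q ->
  2 * n.+1 + Q + Q * (10 * (n * S)) <= 15 * (n * S * Q).
Proof.
move=> n_gt0 S_gt0 Q_gt0.
have nX : n <= n * S * Q by rewrite -mulnA leq_pmulr // muln_gt0 S_gt0.
have QX : Q <= n * S * Q by rewrite leq_pmull // muln_gt0 n_gt0.
by lia.
Qed.

Lemma step_cost_le (n S K Q : nat) :
    0 < n -> 0 < S -> 0 < K -> 0 < Q ->
  n.+1 * K.+1 + K * (15 * (n * S * Q)).+1 <= 20 * (n * S * K * Q).
Proof.
move=> n_gt0 S_gt0 K_gt0 Q_gt0.
have nK4 : n.+1 * K.+1 <= 4 * (n * K) by nia.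
have nKX : n * K <= n * K * (S * Q) by rewrite leq_pmulr // muln_gt0 S_gt0.
have KnK : K <= n * K by rewrite leq_pmull.
by lia.
Qed.

Lemma total_cost_le (n S K Q : nat) :
    0 < n -> 0 < S -> 0 < K -> 0 < Q ->
  1 + n * (20 * (n * S * K * Q)).+1 <= 22 * (n ^ 2 * S * K * Q).
Proof.
move=> n_gt0 S_gt0 K_gt0 Q_gt0; rewrite -mulnn.
have nX : n <= n * (n * S * K * Q).
  by rewrite leq_pmulr // !muln_gt0 n_gt0 S_gt0 K_gt0.
by lia.
Qed.

Local Open Scope fset_scope.
Local Open Scope timed_scope.

Section InducedSubgraphs.
Variable T : choiceType.
Implicit Types (G H : graph T) (U W : {fset T}) (v : T).

Lemma eq_graph G H :
  vertices G = vertices H -> edges G = edges H -> groot G = groot H -> G = H.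
Proof.
move=> eqV eqE eqr; apply: val_inj; move: eqV eqE eqr; rewrite /vertices /edges /groot.
by case: G H => [[[V E] r] _] [[[V' E'] r'] _] /= -> -> ->.
Qed.

Lemma edge_vertices G e :
  e \in edges G -> (e.1 \in vertices G) && (e.2 \in vertices G).
Proof. by case: G => [[[V E] r] wf]; case/andP: (wf) => /allP EV _ /EV. Qed.

Lemma groot_vertices G r : groot G = Some r -> r \in vertices G.
Proof.
case: G => [[[V E] q] wf]; case/andP: (wf) => _ /= rV.
by rewrite /groot /= => qE; rewrite qE in rV.
Qed.

Lemma vertices_induced G U : vertices (induced G U) = vertices G `&` U.
Proof. by []. Qed.

Lemma groot_induced G U :
  groot (induced G U) =
  if groot G is Some r then if r \in U then Some r else None else None.
Proof. by []. Qed.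

Lemma induced_induced G U W : induced (induced G U) W = induced G (U `&` W).
Proof.
apply: eq_graph.
- by rewrite !vertices_induced fsetIA.
- by apply/fsetP => e; rewrite !inE /=; do 5!case: (_ \in _).
- by rewrite !groot_induced; case: (groot G) => // r; rewrite inE; case: ifP.
Qed.

Lemma induced_id G U : vertices G `<=` U -> induced G U = G.
Proof.
move=> /fsubsetP VU; apply: eq_graph.
- by rewrite vertices_induced; apply/fsetIidPl/fsubsetP.
- apply/fsetP => e; rewrite !inE /= andb_idr // => /edge_vertices/andP[e1 e2].
  by rewrite !VU.
- rewrite groot_induced; case rG: (groot G) => [r|] //.
  by rewrite VU //; apply: groot_vertices.
Qed.

Lemma induced_subgraph_induced G U : induced_subgraph (induced G U) G.
Proof.
exists (vertices G `&` U); first exact: fsubsetIl.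
by rewrite -induced_induced (induced_id (fsubset_refl _)).
Qed.

Lemma induced_subgraph_vertices H G :
  induced_subgraph H G -> vertices H `<=` vertices G.
Proof. by move=> [U _ ->]; rewrite vertices_induced fsubsetIl. Qed.

Lemma induced_subgraphE H G : induced_subgraph H G -> H = induced G (vertices H).
Proof.
move=> [U UG ->]; rewrite vertices_induced -induced_induced.
by rewrite (induced_id (fsubset_refl _)).
Qed.

Lemma induced_subgraph_trans G2 G1 G3 :
  induced_subgraph G1 G2 -> induced_subgraph G2 G3 -> induced_subgraph G1 G3.
Proof.
move=> /induced_subgraphE -> /induced_subgraphE ->.
by rewrite induced_induced; apply: induced_subgraph_induced.
Qed.

Lemma induced_subgraph_anti G H :
  induced_subgraph G H -> induced_subgraph H G -> G = H.
Proof.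
move=> GH HG; rewrite (induced_subgraphE GH) induced_id //.
exact: induced_subgraph_vertices.
Qed.

Lemma induced_subgraph_fsubset G H1 H2 :
    induced_subgraph H1 G -> induced_subgraph H2 G ->
  vertices H1 `<=` vertices H2 -> induced_subgraph H1 H2.
Proof.
move=> /induced_subgraphE H1E /induced_subgraphE H2E sub.
exists (vertices H1) => //; rewrite [in RHS]H2E induced_induced.
by rewrite (fsetIidPr sub).
Qed.

Lemma induced_subgraphS G U W :
  U `<=` W -> induced_subgraph (induced G U) (induced G W).
Proof.
move=> UW; apply: (induced_subgraph_fsubset (G := G)).
- exact: induced_subgraph_induced.
- exact: induced_subgraph_induced.
- by rewrite !vertices_induced fsetIS.
Qed.

Lemma leq_card_induced_subgraph H G :
  induced_subgraph H G -> #|` vertices H| <= #|` vertices G|.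
Proof. by move=> /induced_subgraph_vertices/fsubset_leq_card. Qed.

Lemma ltn_card_proper_induced_subgraph H G :
  proper_induced_subgraph H G -> #|` vertices H| < #|` vertices G|.
Proof.
move=> [HG neqHG]; apply: fproper_ltn_card.
rewrite fproperEneq induced_subgraph_vertices // andbT; apply/eqP => eqV.
by apply: neqHG; rewrite (induced_subgraphE HG) induced_id // eqV.
Qed.

Lemma induced_fset0 G : induced G fset0 = graph0 T.
Proof.
apply: eq_graph; first by rewrite vertices_induced fsetI0.
- by apply/fsetP => e; rewrite !inE /= andbF.
- by rewrite groot_induced; case: (groot G).
Qed.

Lemma graph0_subgraph G : induced_subgraph (graph0 T) G.
Proof. by rewrite -(induced_fset0 G); apply: induced_subgraph_induced. Qed.

Lemma induced_add_subgraph G H v : induced_subgraph (induced_add G H v) G.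
Proof. exact: induced_subgraph_induced. Qed.

Lemma vertices_induced_add G H v :
    induced_subgraph H G -> v \in vertices G ->
  vertices (induced_add G H v) = v |` vertices H.
Proof.
move=> /induced_subgraph_vertices sub vG.
by rewrite vertices_induced; apply/fsetIidPr; rewrite fsubUset fsub1set vG.
Qed.

Lemma induced_subgraph_add G H v :
  induced_subgraph H G -> induced_subgraph H (induced_add G H v).
Proof.
move=> HG; rewrite {1}(induced_subgraphE HG).
by apply: induced_subgraphS; apply: fsubsetUr.
Qed.

Lemma induced_add_least G G' H v :
    induced_subgraph G' G -> induced_subgraph H G' -> v \in vertices G' ->
  induced_subgraph (induced_add G H v) G'.
Proof.
move=> G'G HG' vG'; rewrite (induced_subgraphE G'G); apply: induced_subgraphS.
by rewrite fsubUset fsub1set vG' induced_subgraph_vertices.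
Qed.

Definition induced_seq G (us : seq T) : graph T := induced G [fset x in us].

Lemma induced_seq_subgraph G us : induced_subgraph (induced_seq G us) G.
Proof. exact: induced_subgraph_induced. Qed.

Lemma vertices_induced_seq G us :
  {subset us <= vertices G} -> vertices (induced_seq G us) =i us.
Proof. by move=> usG x; rewrite !inE andb_idl // => /usG. Qed.

Lemma induced_seq_nil G : induced_seq G [::] = graph0 T.
Proof. by rewrite /induced_seq fset_nil induced_fset0. Qed.

Lemma induced_seq_rcons G us v :
  induced_seq G (rcons us v) = induced G (v |` [fset x in us]).
Proof.
by congr induced; apply/fsetP => x; rewrite !inE mem_rcons inE.
Qed.

Lemma induced_seq_enumeration G vs :
  vertex_enumeration G vs -> induced_seq G vs = G.
Proof.
move=> [_ vsG]; apply/induced_id/fsubsetP => x.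
by rewrite !inE vsG.
Qed.

End InducedSubgraphs.

Lemma time_bind (A B : Type) (m : timed A) (f : A -> timed B) :
  time (bind m f) = (time m + time (f (result m)))%N.
Proof. by []. Qed.

Lemma time_for_each_le (A : eqType) (S : Type) (l : seq A) (st : S)
    (body : A -> S -> timed S) b :
    (forall a st', a \in l -> time (body a st') <= b) ->
  time (for_each l st body) <= size l * b.+1.
Proof.
elim: l st => //= a l IHl st time_body.
rewrite add1n mulSn addSn ltnS leq_add //; first by rewrite time_body // inE eqxx.
by apply: IHl => a' st' a'l; rewrite time_body // inE a'l orbT.
Qed.

(* An element that was added before its turn to be removed must be put back by
   its own round. *)
Lemma mem_for_each_replace (A : choiceType) (l : seq A) (C : {fset A})
    (body : A -> {fset A} -> timed {fset A}) (new : A -> pred A) x :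
    (forall y z D, (z \in result (body y D)) = (z \in D `\ y) || new y z) ->
    (forall y z, y \in l -> z \in l -> new y z -> new z z) ->
  (x \in result (for_each l C body)) =
  (x \in C) && (x \notin l) || has (new^~ x) l.
Proof.
move=> bodyE; elim: l C => [|y l IHl] C newP /=; first by rewrite andbT orbF.
rewrite IHl => [|z t zl tl]; last by apply: newP; rewrite inE ?zl ?tl orbT.
rewrite bodyE !inE negb_or.
case new_yx: (new y x) => /=; last by rewrite orbF andbCA andbA.
rewrite !orbT /=; case xl: (x \in l) => //=; apply/hasP; exists x => //=.
by apply: (newP y); rewrite ?inE ?eqxx ?xl ?orbT.
Qed.

Lemma uniq_sub_rcons_prefix (A : eqType) (D : {pred A}) (us vs : seq A) v :
    uniq (us ++ v :: vs) -> {subset us ++ v :: vs <= D} ->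
  uniq (rcons us v) /\ {subset rcons us v <= D}.
Proof.
rewrite -cat_rcons cat_uniq => /andP[uniq_usv _] sub.
by split=> // x xus; rewrite sub // mem_cat xus.
Qed.

Section HereditaryProperty.
Variables (T : choiceType) (P : graph T -> Prop).
Hypotheses (P_property : graph_property P) (P_hereditary : hereditary P).
Implicit Types (G H : graph T) (U : {fset T}) (us vs : seq T) (C : {fset graph T}).

Lemma graph0_P_subgraph G : P_subgraph P G (graph0 T).
Proof.
split; first exact: graph0_subgraph.
by have [G' PG'] := P_property; apply: P_hereditary PG' (graph0_subgraph G').
Qed.

Lemma P_subgraph_trans G1 G2 H :
  induced_subgraph G1 G2 -> P_subgraph P G1 H -> P_subgraph P G2 H.
Proof. by move=> G12 [HG1 PH]; split=> //; apply: induced_subgraph_trans G12. Qed.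

Lemma P_subgraph_trace G1 G2 H :
    induced_subgraph G1 G2 -> P_subgraph P G2 H ->
  P_subgraph P G1 (induced H (vertices G1)).
Proof.
move=> G12 [HG2 PH]; have traceH := induced_subgraph_induced H (vertices G1).
split; last exact: P_hereditary traceH.
apply: induced_subgraph_fsubset (induced_subgraph_trans traceH HG2) G12 _.
by rewrite vertices_induced fsubsetIr.
Qed.

Lemma maximal_P_subgraphP G H :
  maximal_P_subgraph P G H <->
  P_subgraph P G H /\
  forall H', P_subgraph P G H' -> induced_subgraph H H' -> H' = H.
Proof.
split=> -[PH maxH]; split=> //.
  move=> H' PH' HH'; apply: contrapT => neq; apply: maxH.
  by exists H'; do 2!split=> //; move=> eqH; apply: neq.
by move=> [H' [PH' [HH' neq]]]; apply: neq; rewrite (maxH H').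
Qed.

Lemma maximal_P_subgraph_extend G H :
    P_subgraph P G H ->
  exists2 H', maximal_P_subgraph P G H' & induced_subgraph H H'.
Proof.
have [k] := ubnP (#|` vertices G| - #|` vertices H|).
elim: k H => // k IHk H ltk PH.
have [maxH|nmaxH] := pselect (maximal_P_subgraph P G H).
  by exists H => //; exists (vertices H) => //; rewrite induced_id.
have [H' [PH' HH']] :
    exists H', P_subgraph P G H' /\ proper_induced_subgraph H H'.
  by apply: contrapT => noext; apply: nmaxH.
have ltHH' := ltn_card_proper_induced_subgraph HH'.
have leH'G := leq_card_induced_subgraph (proj1 PH').
have [|//|H2 maxH2 H'H2] := IHk H'; first by lia.
by exists H2 => //; apply: induced_subgraph_trans H'H2; case: HH'.
Qed.

Lemma maximal_P_subgraph_sub G1 G2 H :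
    induced_subgraph G1 G2 -> induced_subgraph H G1 ->
  maximal_P_subgraph P G2 H -> maximal_P_subgraph P G1 H.
Proof.
move=> G12 HG1 /maximal_P_subgraphP[[_ PH] maxH].
apply/maximal_P_subgraphP; split=> // H' PH'.
by apply: maxH; apply: P_subgraph_trans PH'.
Qed.

Lemma maximal_P_subgraph_trace G1 G2 H H' :
    induced_subgraph G1 G2 -> maximal_P_subgraph P G1 H ->
    P_subgraph P G2 H' -> induced_subgraph H H' ->
  induced H' (vertices G1) = H.
Proof.
move=> G12 /maximal_P_subgraphP[[HG1 PH] maxH] PH' HH'.
apply: maxH; first exact: P_subgraph_trace G12 PH'.
rewrite (induced_subgraphE HH'); apply: induced_subgraphS.
exact: induced_subgraph_vertices.
Qed.

Lemma leq_card_max_P_subgraphs G1 G2 :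
  induced_subgraph G1 G2 ->
  #|` max_P_subgraphs P G1| <= #|` max_P_subgraphs P G2|.
Proof.
move=> G12; pose trace H := induced H (vertices G1).
apply: leq_trans (leq_imfset_card imfset_key trace (mem (max_P_subgraphs P G2))).
apply/fsubset_leq_card/fsubsetP => H /in_max_P_subgraphs maxH.
have [H' maxH' HH'] := maximal_P_subgraph_extend (P_subgraph_trans G12 (proj1 maxH)).
apply/imfsetP; exists H'; first exact/in_max_P_subgraphs.
by rewrite /trace (maximal_P_subgraph_trace G12 maxH (proj1 maxH')).
Qed.

Lemma card_max_P_subgraphs_gt0 G : 0 < #|` max_P_subgraphs P G|.
Proof.
have [H maxH _] := maximal_P_subgraph_extend (graph0_P_subgraph G).
by rewrite cardfs_gt0; apply/fset0Pn; exists H; apply/in_max_P_subgraphs.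
Qed.

Lemma max_P_subgraphs_graph0 : max_P_subgraphs P (graph0 T) = [fset graph0 T].
Proof.
have sub0 H : induced_subgraph H (graph0 T) -> H = graph0 T.
  by move=> H0; apply: induced_subgraph_anti H0 (graph0_subgraph H).
apply/fsetP => H; rewrite in_fset1; apply/idP/eqP => [|->].
  by move=> /in_max_P_subgraphs[[/sub0]].
apply/in_max_P_subgraphs/maximal_P_subgraphP.
by split=> [|H' [/sub0]//]; apply: graph0_P_subgraph.
Qed.

Lemma maximal_P_subgraph_add1P G G' H :
    induced_subgraph G' G ->
  maximal_P_subgraph P G' H <->
  P_subgraph P G' H /\
  forall v, v \in vertices G' -> v \notin vertices H -> ~ P (induced_add G H v).
Proof.
move=> G'G; rewrite maximal_P_subgraphP.
split=> -[PH maxH]; split=> //; have [HG' _] := PH.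
  move=> v vG' /negP vH Pv; apply: vH.
  have HG := induced_subgraph_trans HG' G'G.
  have vG := fsubsetP (induced_subgraph_vertices G'G) v vG'.
  rewrite -(maxH (induced_add G H v)); last exact: induced_subgraph_add.
    by rewrite vertices_induced_add // fset1U1.
  by split=> //; apply: induced_add_least.
move=> H' [H'G' PH'] HH'; apply: induced_subgraph_anti (HH').
apply: (induced_subgraph_fsubset H'G' HG'); apply/fsubsetP => v vH'.
apply: contraT => vH.
case: (maxH v (fsubsetP (induced_subgraph_vertices H'G') v vH') vH).
apply: P_hereditary PH' _; apply: induced_add_least => //.
exact: induced_subgraph_trans H'G' G'G.
Qed.

Lemma almost_satisfies_add G H v :
    P_subgraph P G H -> v \in vertices G -> v \notin vertices H ->
  almost_satisfies P (induced_add G H v).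
Proof.
move=> [HG PH] vG vH; exists v; first by rewrite vertices_induced_add // fset1U1.
rewrite /del_vertex vertices_induced_add // fsetU1K // induced_induced.
by rewrite (fsetIidPr (fsubsetUr _ _)) -induced_subgraphE.
Qed.

Lemma maximal_P_subgraph_in_add G U v H' :
    v \in vertices G -> maximal_P_subgraph P (induced G (v |` U)) H' ->
  exists2 H, maximal_P_subgraph P (induced G U) H &
    maximal_P_subgraph P (induced_add G H v) H'.
Proof.
move=> vG maxH'; have [PH' _] := maxH'; have [H'GvU _] := PH'.
have GvUG := induced_subgraph_induced G (v |` U).
have GU_GvU := induced_subgraphS G (fsubsetUr [fset v] U).
have [H maxH traceH] :=
  maximal_P_subgraph_extend (P_subgraph_trace GU_GvU PH').
have [[HGU _] _] := maxH.
have HGvU := induced_subgraph_trans HGU GU_GvU.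
exists H => //; apply: maximal_P_subgraph_sub maxH'.
  by apply: induced_add_least => //; rewrite !inE vG eqxx.
apply: induced_subgraph_fsubset (induced_subgraph_trans H'GvU GvUG)
  (induced_add_subgraph G H v) _.
rewrite vertices_induced_add //; last exact: induced_subgraph_trans GvUG.
apply/fsubsetP => x xH'.
have := fsubsetP (induced_subgraph_vertices H'GvU) x xH'.
rewrite !inE => /andP[xG /orP[-> //|xU]].
by rewrite (fsubsetP (induced_subgraph_vertices traceH)) ?orbT // !inE xH' xG.
Qed.

Section GenHered.
Variables (M : graph T -> timed bool) (s : nat -> nat).
Variables (R : graph T -> timed (seq (graph T))) (r : nat -> nat -> nat).
Hypotheses (M_test : membership_test P M s) (R_proc : restricted_procedure P R r).

Lemma no_extensionP G us H :
  result (no_extension M G us H) <->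
  forall v, v \in us -> v \notin vertices H -> ~ P (induced_add G H v).
Proof.
elim: us => [|u us IHus] //=.
have consP : (forall v, v \in u :: us -> v \notin vertices H ->
      ~ P (induced_add G H v)) <->
    (u \notin vertices H -> ~ P (induced_add G H u)) /\
    result (no_extension M G us H).
  rewrite IHus; split=> [noext|[noextu noext] v].
    by split=> [|v vus]; apply: noext; rewrite inE ?eqxx ?vus ?orbT.
  by rewrite inE => /predU1P[-> //|]; apply: noext.
rewrite consP; case: ifPn => uH /=; first by split=> [|[]].
have := test_correct M_test (induced_add G H u).
case: (result (M _)) => /= -[MP PM]; last by split=> [|[]] //; split=> // _ /PM.
by split=> // -[/(_ isT (MP isT))].
Qed.

Lemma maximality_testP n G us H :
    {subset us <= vertices G} -> induced_subgraph H (induced_seq G us) ->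
  result (maximality_test M n G us H) <->
  maximal_P_subgraph P (induced_seq G us) H.
Proof.
move=> usG HGus; rewrite (maximal_P_subgraph_add1P _ (induced_seq_subgraph G us)).
rewrite /maximality_test /=; have := test_correct M_test H.
case: (result (M H)) => /= -[MP PM]; last by split=> // -[[_ /PM]].
have PH := MP isT; rewrite no_extensionP.
split=> [noext|[_ noext] v vus]; last by apply: noext; rewrite vertices_induced_seq.
by split=> // v; rewrite vertices_induced_seq //; apply: noext.
Qed.

Lemma time_M_le G H : induced_subgraph H G -> time (M H) <= s #|` vertices G|.
Proof.
move=> HG; apply: leq_trans (test_time M_test H) _.
by apply: test_mono M_test _ _ _; apply: leq_card_induced_subgraph.
Qed.

Lemma time_no_extension_le G us H :
  time (no_extension M G us H) <= size us * (s #|` vertices G| + 3).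
Proof.
elim: us => //= u us IHus; have := time_M_le (induced_add_subgraph G H u).
by case: ifP => _ /=; [|case: ifP => _ /=]; lia.
Qed.

Lemma time_R_le G H :
    induced_subgraph H G -> almost_satisfies P H ->
  time (R H) <= r #|` vertices G| #|` max_P_subgraphs P G|.
Proof.
move=> HG almostH; apply: leq_trans (proc_time R_proc almostH) _.
apply: proc_mono R_proc _ _ _ _ _ _; last exact: leq_card_max_P_subgraphs.
exact: leq_card_induced_subgraph.
Qed.

Lemma membership_bound_gt0 G : 0 < s #|` vertices G|.
Proof. exact: leq_trans (test_pos M_test G) (test_time M_test G). Qed.

Lemma procedure_bound_gt0 G :
  0 < #|` vertices G| -> 0 < r #|` vertices G| #|` max_P_subgraphs P G|.
Proof.
rewrite cardfs_gt0 => /fset0Pn[v vG]; pose H := induced_add G (graph0 T) v.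
have almostH : almost_satisfies P H.
  exact: almost_satisfies_add (graph0_P_subgraph G) vG _.
apply: leq_trans (time_R_le (induced_add_subgraph _ _ _) almostH).
apply: leq_trans (proc_output R_proc almostH).
have := card_max_P_subgraphs_gt0 H.
rewrite cardfs_gt0 => /fset0Pn[H']; rewrite -(proc_correct R_proc almostH).
by case: (result _).
Qed.

Definition insert_maximal n G us (Hs : seq (graph T)) C : timed {fset graph T} :=
  for_each Hs C (fun H C' =>
    b <-- maximality_test M n G us H ;;
    if b then coll_add n H C' else ret C').

Definition replace_subgraph n G us v H C : timed {fset graph T} :=
  C' <-- coll_remove n H C ;;
  tick n.+1 ;;;
  Hs <-- R (induced_add G H v) ;;
  insert_maximal n G us Hs C'.

Lemma gen_hered_stepE n G us v C :
  gen_hered_step M R n G us v C =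
  (Hs <-- coll_copy n C ;; for_each Hs C (replace_subgraph n G us v)).
Proof. by []. Qed.

Lemma mem_insert_maximal n G us Hs C H :
  (H \in result (insert_maximal n G us Hs C)) =
  (H \in C) || (H \in Hs) && result (maximality_test M n G us H).
Proof.
rewrite /insert_maximal; elim: Hs C => [|H1 Hs IHs] C /=; first by rewrite orbF.
rewrite IHs inE; case: (boolP (result (maximality_test M n G us H1))) => testH1.
  by rewrite !inE; have [->|] := eqVneq H H1; rewrite /= ?testH1 ?orbT.
by have [->|] := eqVneq H H1; rewrite /= ?(negbTE testH1) ?andbF.
Qed.

Section Round.
Variables (G : graph T) (us : seq T) (v : T).
Hypotheses (uniq_usv : uniq (rcons us v)) (usv_sub : {subset rcons us v <= vertices G}).

Local Notation n := #|` vertices G|.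
Local Notation K := #|` max_P_subgraphs P G|.
Local Notation Q := (r n K).
Local Notation Gus := (induced_seq G us).
Local Notation Gusv := (induced_seq G (rcons us v)).

Lemma new_vertex_in : v \in vertices G.
Proof. by apply: usv_sub; rewrite mem_rcons inE eqxx. Qed.

Lemma almost_satisfies_add_new H :
  P_subgraph P Gus H -> almost_satisfies P (induced_add G H v).
Proof.
move=> PH; apply: almost_satisfies_add new_vertex_in _.
  exact: P_subgraph_trans (induced_seq_subgraph G us) PH.
move: uniq_usv; rewrite rcons_uniq => /andP[vus _]; apply: contra vus.
move=> /(fsubsetP (induced_subgraph_vertices (proj1 PH))).
by rewrite !inE => /andP[].
Qed.

Lemma induced_add_new_subgraph H :
  induced_subgraph H Gus -> induced_subgraph (induced_add G H v) Gusv.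
Proof.
move=> HGus; apply: induced_add_least; first exact: induced_seq_subgraph.
  rewrite induced_seq_rcons; apply: induced_subgraph_trans HGus _.
  by apply: induced_subgraphS; apply: fsubsetUr.
by rewrite vertices_induced_seq // mem_rcons inE eqxx.
Qed.

Definition accepted m H : pred (graph T) := fun H' =>
  (H' \in result (R (induced_add G H v)))
  && result (maximality_test M m G (rcons us v) H').

Lemma acceptedP m H H' :
    P_subgraph P Gus H ->
  accepted m H H' <->
  maximal_P_subgraph P (induced_add G H v) H' /\ maximal_P_subgraph P Gusv H'.
Proof.
move=> PH; rewrite /accepted (proc_correct R_proc (almost_satisfies_add_new PH)).
have addGusv := induced_add_new_subgraph (proj1 PH).
split=> [/andP[/in_max_P_subgraphs maxH' test]|[maxH' maxH'usv]].
  split=> //; apply/(maximality_testP m) => //.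
  by apply: induced_subgraph_trans addGusv; case: maxH' => -[].
apply/andP; split; first exact/in_max_P_subgraphs.
by apply/maximality_testP => //; case: maxH'usv => -[].
Qed.

Lemma accepted_self m H1 H2 :
    P_subgraph P Gus H1 -> P_subgraph P Gus H2 ->
  accepted m H1 H2 -> accepted m H2 H2.
Proof.
move=> PH1 PH2 /(acceptedP _ _ PH1)[_ maxH2].
apply/(acceptedP _ _ PH2); split=> //; have [H2Gus _] := PH2.
apply: maximal_P_subgraph_sub (induced_add_new_subgraph H2Gus) _ maxH2.
exact/induced_subgraph_add/(induced_subgraph_trans H2Gus)/induced_seq_subgraph.
Qed.

Lemma result_gen_hered_step m :
  result (gen_hered_step M R m G (rcons us v) v (max_P_subgraphs P Gus)) =
  max_P_subgraphs P Gusv.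
Proof.
have GusP H : H \in max_P_subgraphs P Gus -> P_subgraph P Gus H.
  by move=> /in_max_P_subgraphs[].
apply/fsetP => H'; rewrite gen_hered_stepE /=.
rewrite (@mem_for_each_replace _ _ _ _ (accepted m)).
- rewrite andbN /=; apply/hasP/idP => [[H /GusP PH]|/in_max_P_subgraphs maxH'].
    by move=> /(acceptedP _ _ PH)[_ maxH']; apply/in_max_P_subgraphs.
  have := maxH'; rewrite induced_seq_rcons.
  move=> /(maximal_P_subgraph_in_add new_vertex_in)[H maxH maxaddH].
  exists H; first exact/in_max_P_subgraphs.
  by apply/acceptedP => //; case: maxH.
- by move=> H1 H2 D; rewrite mem_insert_maximal.
- by move=> H1 H2 /GusP PH1 /GusP PH2; apply: accepted_self.
Qed.

Lemma card_vertices_gt0 : 0 < n.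
Proof. by rewrite cardfs_gt0; apply/fset0Pn; exists v; apply: new_vertex_in. Qed.

Lemma time_maximality_test_le H :
    induced_subgraph H G ->
  time (maximality_test M n G (rcons us v) H) <= 7 * (n * s n).
Proof.
move=> HG; have size_usv : size (rcons us v) <= n by apply: uniq_leq_size.
apply: leq_trans (maximality_cost_le card_vertices_gt0 (membership_bound_gt0 G)).
have timeM := time_M_le HG.
have time_ext := leq_trans (time_no_extension_le G (rcons us v) H)
  (leq_mul size_usv (leqnn _)).
by rewrite /maximality_test /=; case: ifP => _ /=; lia.
Qed.

Lemma time_insert_maximal_le Hs C :
    (forall H, H \in Hs -> induced_subgraph H G) ->
  time (insert_maximal n G (rcons us v) Hs C) <= size Hs * (10 * (n * s n)).
Proof.
move=> HsG; have ns_gt0 : 0 < n * s n.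
  by rewrite muln_gt0 card_vertices_gt0 membership_bound_gt0.
have n_le_ns : n <= n * s n by rewrite leq_pmulr // membership_bound_gt0.
have time_body H C' : H \in Hs ->
    time (b <-- maximality_test M n G (rcons us v) H ;;
          if b then coll_add n H C' else ret C') <= 9 * (n * s n).
  move=> /HsG/time_maximality_test_le; rewrite time_bind.
  by case: (result _) => /=; lia.
apply: leq_trans (time_for_each_le C time_body) (leq_mul (leqnn _) _).
by lia.
Qed.

Lemma time_replace_subgraph_le H C :
    P_subgraph P Gus H ->
  time (replace_subgraph n G (rcons us v) v H C) <= 15 * (n * s n * Q).
Proof.
move=> PH; have almostH := almost_satisfies_add_new PH.
have addG := induced_add_subgraph G H v.
have timeR := time_R_le addG almostH.
have sizeR := leq_trans (proc_output R_proc almostH) timeR.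
have RG H' : H' \in result (R (induced_add G H v)) -> induced_subgraph H' G.
  rewrite (proc_correct R_proc almostH) => /in_max_P_subgraphs[[H'add _] _].
  exact: induced_subgraph_trans H'add addG.
have time_insert := leq_trans (time_insert_maximal_le (C `\ H) RG)
  (leq_mul sizeR (leqnn _)).
apply: leq_trans (replacement_cost_le card_vertices_gt0 (membership_bound_gt0 G)
  (procedure_bound_gt0 card_vertices_gt0)).
by rewrite /replace_subgraph /= addn0 mul2n -addnn -!addnA !leq_add2l leq_add.
Qed.

Lemma time_gen_hered_step_le :
  time (gen_hered_step M R n G (rcons us v) v (max_P_subgraphs P Gus)) <=
  20 * (n * s n * K * Q).
Proof.
have card_Gus := leq_card_max_P_subgraphs (induced_seq_subgraph G us).
apply: leq_trans (step_cost_le card_vertices_gt0 (membership_bound_gt0 G)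
  (card_max_P_subgraphs_gt0 G) (procedure_bound_gt0 card_vertices_gt0)).
rewrite gen_hered_stepE /= addn0 leq_add ?leq_mul2l //.
apply: leq_trans (time_for_each_le _ _) (leq_mul card_Gus (leqnn _)) => H C.
by move=> /in_max_P_subgraphs[PH _]; apply: time_replace_subgraph_le.
Qed.

End Round.

Lemma result_gen_hered_loop n G us vs :
    uniq (us ++ vs) -> {subset us ++ vs <= vertices G} ->
  result (gen_hered_loop M R n G us vs (max_P_subgraphs P (induced_seq G us))) =
  max_P_subgraphs P (induced_seq G (us ++ vs)).
Proof.
elim: vs us => [|v vs IHvs] us uniq_us sub /=; first by rewrite cats0.
have [uniq_usv sub_usv] := uniq_sub_rcons_prefix uniq_us sub.
by rewrite result_gen_hered_step // IHvs cat_rcons.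
Qed.

Lemma result_gen_hered G vs :
  vertex_enumeration G vs -> result (gen_hered M R G vs) = max_P_subgraphs P G.
Proof.
move=> enum_vs; have [uniq_vs vsG] := enum_vs.
rewrite /gen_hered /= -max_P_subgraphs_graph0 -(induced_seq_nil G).
by rewrite result_gen_hered_loop ?induced_seq_enumeration // => x; rewrite vsG.
Qed.

Lemma time_gen_hered_loop_le G us vs
    (n := #|` vertices G|) (K := #|` max_P_subgraphs P G|) :
    uniq (us ++ vs) -> {subset us ++ vs <= vertices G} ->
  time (gen_hered_loop M R n G us vs (max_P_subgraphs P (induced_seq G us))) <=
  size vs * (20 * (n * s n * K * r n K)).+1.
Proof.
elim: vs us => [|v vs IHvs] us uniq_us sub //.
have [uniq_usv sub_usv] := uniq_sub_rcons_prefix uniq_us sub.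
rewrite /gen_hered_loop -/gen_hered_loop !time_bind result_gen_hered_step //.
by rewrite add1n mulSn addSn ltnS leq_add ?time_gen_hered_step_le ?IHvs ?cat_rcons.
Qed.

Lemma time_gen_hered_le G vs :
    vertex_enumeration G vs ->
  let n := size vs in
  let K := #|` max_P_subgraphs P G| in
  0 < n -> time (gen_hered M R G vs) <= 22 * (n ^ 2 * s n * K * r n K).
Proof.
move=> [uniq_vs vsG] n K.
have sizeE : size vs = #|` vertices G|.
  by apply/perm_size/uniq_perm; rewrite ?fset_uniq.
have sub_vs : {subset vs <= vertices G} by move=> x; rewrite vsG.
rewrite /n /gen_hered sizeE time_bind => n_gt0.
apply: leq_trans (total_cost_le n_gt0 (membership_bound_gt0 G)
  (card_max_P_subgraphs_gt0 G) (procedure_bound_gt0 n_gt0)).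
have := @time_gen_hered_loop_le G [::] vs uniq_vs sub_vs.
by rewrite induced_seq_nil max_P_subgraphs_graph0 sizeE leq_add2l.
Qed.

End GenHered.

End HereditaryProperty.

Theorem theorem5p1 (T : choiceType) (P : graph T -> Prop)
    (M : graph T -> timed bool) (s : nat -> nat)
    (R : graph T -> timed (seq (graph T))) (r : nat -> nat -> nat)
    (P_property : graph_property P) (P_hereditary : hereditary P)
    (M_test : membership_test P M s) (s_poly : polynomially_bounded s)
    (R_proc : restricted_procedure P R r) :
  (forall (G : graph T) (vs : seq T), vertex_enumeration G vs ->
     result (gen_hered M R G vs) = max_P_subgraphs P G)
  /\
  exists C : nat, forall (G : graph T) (vs : seq T), vertex_enumeration G vs ->
    let n := size vs in
    let K := #|` max_P_subgraphs P G| in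
    0 < n ->
    time (gen_hered M R G vs) <= C * (n ^ 2 * s n * K * r n K).
Proof.
split=> [G vs|]; first exact: (result_gen_hered P_property P_hereditary M_test R_proc).
exists 22 => G vs; exact: (time_gen_hered_le P_property P_hereditary M_test R_proc).
Qed.
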